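(* For every integer $n\geq 1$ with $n\not\equiv 2 \pmod 4$, $c_5(n)=c_6(n)$, where $c_5(n)=|\mathcal C_n^{++-}|$ and $c_6(n)=|\mathcal C_n^{+--}|$; thus the signatures $++-$ and $+--$ are weakly c-Wilf-equivalent.
   Context: $\mathcal S_n$ is the set of permutations of $[n]$ in one-line notation $\pi=\pi_1\cdots\pi_n$; $\mathcal C_n$ is the set of cyclic permutations (single $n$-cycle) in $\mathcal S_n$. For $\sigma=\sigma^0\cdots\sigma^{k-1}\in\{+,-\}^k$, $\mathcal S^\sigma_n$ is the set of $\pi\in\mathcal S_n$ for which there exist $0=e_0\le e_1\le\cdots\le e_k=n$ with each segment $\pi_{e_i+1}\cdots\pi_{e_{i+1}}$ increasing if $\sigma^i=+$ and decreasing if $\sigma^i=-$; $\mathcal C_n^\sigma=\mathcal C_n\cap\mathcal S_n^\sigma$. Two signatures are weakly c-Wilf-equivalent if for every $n\not\equiv 2\pmod 4$ they have equally many cyclic permutations of length $n$ in their classes. *)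

(* Defs.v *)
From mathcomp Require Import all_boot all_fingroup.
Set Implicit Arguments. Unset Strict Implicit. Unset Printing Implicit Defensive.

(* One-line notation of pi in S_n, with values shifted to {0,..,n-1}
   (monotonicity of segments is unaffected by the shift). *)
Definition oneline n (s : 'S_n) : seq nat := [seq val (s i) | i <- enum 'I_n].

Definition cyclicp n (s : 'S_n) : bool := #|porbits s| == 1%N.

(* Signatures: true = '+', false = '-'. *)
Definition signature := seq bool.

Definition in_class (n : nat) (sigma : signature) (w : seq nat) : bool :=
  [exists e : {ffun 'I_(size sigma).+1 -> 'I_n.+1},
    [&& val (e ord0) == 0, val (e ord_max) == n,
        [forall i : 'I_(size sigma).+1, forall j : 'I_(size sigma).+1,
           (i <= j) ==> (e i <= e j)] &
        [forall i : 'I_(size sigma),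
           let seg := drop (e (inord i)) (take (e (inord i.+1)) w) in
           if nth true sigma i then sorted ltn seg
           else sorted (fun a b => b < a) seg]]].

Definition Cclass (sigma : signature) (n : nat) : {set 'S_n} :=
  [set s : 'S_n | cyclicp s && in_class n sigma (oneline s)].

Definition cnt (sigma : signature) (n : nat) : nat := #|Cclass sigma n|.

Definition c5 n := cnt [:: true; true; false] n.
Definition c6 n := cnt [:: true; false; false] n.

(* Main.v *)
Require Import Defs.
From mathcomp Require Import all_boot all_fingroup cyclic.
From mathcomp Require Import zify.
Set Implicit Arguments. Unset Strict Implicit. Unset Printing Implicit Defensive.

(** A permutation in the class of ++- that is not unimodal has exactly two pairs
    of cuts e1 <= e2; for a unimodal one the number of pairs exceeds 2 by the
    sum of its two +- cuts, plus 1 unless it is increasing. Hence 2 c5(n) is the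
    number of triples (s, e1, e2) with s cyclic and cut by e1 <= e2 according to
    ++-, minus the sum of e over the pairs (s, e) with s cyclic and cut by e
    according to +-, minus a correction; symmetrically for +-- with n - e
    instead of e. The two corrections agree because a cyclic permutation of
    length other than 2 is increasing iff it is decreasing.

    So it suffices that changing every sign and reversing the order of the
    segments preserves the number of cyclic permutations with given cuts.
    Conjugation by the reversal of [n] reverses the segments without changing
    signs. To change all signs, write a cyclic s as the conjugate of the
    rotation by a permutation r, i.e. as a linear order on Z/n, and let w be the
    word of segment indices read along the cycle. The order of two points is
    governed by the first time t at which their itineraries in w part, and
    changing all signs reverses it exactly when t is odd. Two distinct points
    with equal itineraries must be n/2 apart, so for n not 2 mod 4 they have the
    same parity on Z/n, and that parity can be used in place of t. *)

(** * Tournaments and permutations *)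

Definition tournament (T : eqType) (L : rel T) : Prop :=
  irreflexive L /\ forall x y, x != y -> L y x = ~~ L x y.

Lemma ltn_perm_tournament n (s : 'S_n) : tournament (fun i j => s i < s j).
Proof.
split=> [i | i j]; first exact: ltnn.
by rewrite -(inj_eq (@perm_inj _ s)) -val_eqE; case: ltngtP.
Qed.

Lemma card_ltn_ord n k : k <= n -> #|[set i : 'I_n | i < k]| = k.
Proof.
move=> le_kn; rewrite cardsE -sum1_card -(big_ord_widen n (fun=> 1)) //.
by rewrite sum_nat_const card_ord muln1.
Qed.

Lemma eq_perm_ltn n (s t : 'S_n) :
  (forall i j, (s i < s j) = (t i < t j)) -> s = t.
Proof.
have rankE (q : 'S_n) j : q j = #|[set i | q i < q j]| :> nat.
  transitivity #|q @^-1: [set i : 'I_n | i < q j]|.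
    by rewrite card_preimset ?card_ltn_ord // 1?ltnW //; apply: perm_inj.
  by apply: eq_card => i; rewrite !inE.
move=> lt_st; apply/permP => j; apply: val_inj.
rewrite /= [LHS]rankE [RHS]rankE.
by apply: eq_card => i; rewrite !inE lt_st.
Qed.

Lemma perm_of_tournament n (L : rel 'I_n) : tournament L -> transitive L ->
  exists s : 'S_n, forall i j, (s i < s j) = L i j.
Proof.
move=> [L_irr L_tot] L_tr; pose rank j := #|[set i | L i j]|.
have rank_lt i j : L i j -> rank i < rank j.
  move=> Lij; apply/proper_card/properP; split.
    by apply/subsetP => k; rewrite !inE => Lki; apply: L_tr Lij.
  by exists i; rewrite !inE ?L_irr.
have rank_ltn j : rank j < n.
  rewrite -[n in _ < n]card_ord -cardsT; apply/proper_card/properP.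
  by split; [apply: subsetT | exists j; rewrite !inE ?L_irr].
pose pos j := Ordinal (rank_ltn j).
have posE i j : (pos i < pos j) = L i j.
  have [->|ne] := eqVneq i j; first by rewrite ltnn L_irr.
  case Lij: (L i j); first exact: rank_lt.
  by apply/negbTE; rewrite -leqNgt ltnW // rank_lt // L_tot ?Lij.
have pos_inj : injective pos.
  move=> i j eq_pos; apply/eqP; apply: contraT => ne.
  by have := L_tot _ _ ne; rewrite -!posE eq_pos ltnn.
by exists (perm pos_inj) => i j; rewrite !permE posE.
Qed.

Lemma homo_comp_perm n (f : nat -> nat) (q : 'S_n) :
    {homo f : i j / i <= j} ->
    (forall i j : 'I_n, i <= j -> f (q i) <= f (q j)) ->
  forall i, f (q i) = f i.
Proof.
move=> f_homo fq_homo i.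
have enum_sorted : sorted (fun i j : 'I_n => i <= j) (enum 'I_n).
  by have := iota_sorted 0 n; rewrite -val_enum_ord sorted_map.
have /eq_in_map-> // :
    [seq f (q j) | j <- enum 'I_n] = [seq f j | j : 'I_n <- enum 'I_n].
  apply: (sorted_eq leq_trans anti_leq).
  - exact: (homo_sorted fq_homo _ enum_sorted).
  - exact: (homo_sorted (fun j k : 'I_n => @f_homo j k) _ enum_sorted).
  rewrite (map_comp (fun j : 'I_n => f j) q); apply: perm_map.
  apply: uniq_perm; rewrite ?(map_inj_uniq perm_inj) ?enum_uniq // => j.
  by rewrite mem_enum -[j](permKV q) map_f ?mem_enum.
by rewrite mem_enum.
Qed.

Section Rotation.

Variable n : nat.

Definition rotation : 'S_n := perm (@ordS_inj n).

Lemma val_iter_rotation k (j : 'I_n) : iter k rotation j = (j + k) %% n :> nat.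
Proof.
elim: k => [|k IH]; first by rewrite addn0 modn_small.
by rewrite iterS permE /= IH -addn1 modnDml addn1 addnS.
Qed.

Lemma iter_rotation_inj k : injective (iter k rotation).
Proof. by elim: k => //= k IH j l /perm_inj/IH. Qed.

Lemma iter_rotation_mod k (j : 'I_n) :
  iter (k %% n) rotation j = iter k rotation j.
Proof. by apply: val_inj; rewrite /= !val_iter_rotation modnDmr. Qed.

Lemma iter_rotation_eq k (j l : 'I_n) :
  j + k = l %[mod n] -> iter k rotation j = l.
Proof.
by move=> jkl; apply: val_inj; rewrite /= val_iter_rotation jkl modn_small.
Qed.

Lemma iter_rotation_trans (j l : 'I_n) : exists k, iter k rotation j = l.
Proof.
exists (n - j + l); apply: iter_rotation_eq.
by rewrite addnA subnKC ?modnDl // ltnW.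
Qed.

End Rotation.

Arguments rotation {n}.

Section Itineraries.

Variables (n : nat) (w : 'I_n -> nat).

Definition itinerary (j : 'I_n) (k : nat) : nat := w (iter k rotation j).

Definition twins (j l : 'I_n) : bool :=
  [forall k : 'I_n, itinerary j k == itinerary l k].

Definition part_at (k : nat) (j l : 'I_n) : bool :=
  (itinerary j k != itinerary l k)
  && [forall i : 'I_k, itinerary j i == itinerary l i].

Lemma itinerary_iter i j k :
  itinerary (iter i rotation j) k = itinerary j (k + i).
Proof. by rewrite /itinerary iterD. Qed.

Lemma itinerary_rotation j k : itinerary (rotation j) k = itinerary j k.+1.
Proof. by rewrite (itinerary_iter 1) addn1. Qed.

Lemma twinsP j l : reflect (itinerary j =1 itinerary l) (twins j l).
Proof.
apply: (iffP forallP) => [same k | same k]; last by rewrite same.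
rewrite /itinerary -iter_rotation_mod -[in RHS]iter_rotation_mod.
have n_gt0 : 0 < n by apply: leq_ltn_trans (ltn_ord j).
exact/eqP/(same (Ordinal (ltn_pmod k n_gt0))).
Qed.

Lemma part_atP k j l :
  reflect (itinerary j k <> itinerary l k /\
           forall i, i < k -> itinerary j i = itinerary l i)
          (part_at k j l).
Proof.
apply: (iffP andP) => -[/eqP ne same]; split=> //.
  by move=> i lt_ik; apply/eqP/(forallP same (Ordinal lt_ik)).
by apply/forallP => i; apply/eqP/same.
Qed.

Lemma part_atC k j l : part_at k j l = part_at k l j.
Proof.
rewrite /part_at eq_sym; congr (_ && _).
by apply: eq_forallb => i; rewrite eq_sym.
Qed.

Lemma part_at_uniq j l k k' : part_at k j l -> part_at k' j l -> k = k'.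
Proof.
move=> /part_atP[ne same] /part_atP[ne' same'].
by case: (ltngtP k k') => // [/same' | /same].
Qed.

Lemma twins_not_part j l k : twins j l -> ~~ part_at k j l.
Proof. by move/twinsP=> same; rewrite /part_at same eqxx. Qed.

Lemma twins_or_part j l : twins j l \/ exists k : 'I_n, part_at k j l.
Proof.
have [|apart] := boolP (twins j l); [by left | right].
have apart_n : exists k, (k < n) && (itinerary j k != itinerary l k).
  by case/forallPn: apart => k ne; exists k; rewrite ltn_ord.
case: (ex_minnP apart_n) => k /andP[lt_kn ne] k_min.
exists (Ordinal lt_kn); apply/part_atP; split; first exact/eqP.
move=> i lt_ik; apply/eqP; apply: contraTT (lt_ik) => ne_i.
by rewrite -leqNgt k_min // ne_i (ltn_trans lt_ik).
Qed.

Lemma twins_rotation j l :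
  w j = w l -> twins (rotation j) (rotation l) = twins j l.
Proof.
move=> eq_w; apply/twinsP/twinsP => same k; last by rewrite !itinerary_rotation.
by case: k => [//|k]; rewrite -!itinerary_rotation.
Qed.

Lemma part_at_rotation k j l :
  w j = w l -> part_at k (rotation j) (rotation l) = part_at k.+1 j l.
Proof.
move=> eq_w; apply/part_atP/part_atP; rewrite !itinerary_rotation => -[ne same].
  by split=> // -[//|i] lt_ik; rewrite -!itinerary_rotation same.
by split=> // i lt_ik; rewrite !itinerary_rotation same.
Qed.

End Itineraries.

Lemma sum_periodic d (a : nat -> nat) k : (forall i, a (d + i) = a i) ->
  \sum_(i < k * d) a i = k * \sum_(i < d) a i.
Proof.
move=> a_per; elim: k => [|k IH]; first by rewrite !mul0n big_ord0.
rewrite !mulSn big_split_ord /=; congr (_ + _).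
by rewrite -IH; apply: eq_bigr => i _; rewrite a_per.
Qed.

Lemma monotone_walk_not_closed (T : eqType) (L : rel T) (x : nat -> T) b n :
    tournament L -> transitive L -> (forall k, x k != x k.+1) ->
    (forall k, L (x k) (x k.+1) = b) ->
  0 < n -> x n != x 0.
Proof.
move=> [L_irr L_tot] L_tr x_ne x_step n_gt0; apply/eqP => x_n.
case: b x_step => x_step.
  have := homo_ltn (r := L) (fun b a c => @L_tr b a c) x_step n_gt0.
  by rewrite x_n L_irr.
have x_step_rev k : L (x k.+1) (x k) by rewrite L_tot ?x_step.
have L_rev_tr b a c : L b a -> L c b -> L c a by move=> ba cb; apply: L_tr ba.
have := homo_ltn (r := fun a b => L b a) L_rev_tr x_step_rev n_gt0.
by rewrite x_n L_irr.
Qed.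

Definition twisted n (w : 'I_n -> nat) (neg : nat -> bool) (L : rel 'I_n) :
    Prop :=
  forall j l, j != l -> w j = w l ->
    L (rotation j) (rotation l) = L j l (+) neg (w j).

Definition antipodal_twins n (w : 'I_n -> nat) : Prop :=
  forall j l : 'I_n, j != l -> twins w j l -> n = (l - j + (j - l)).*2.

Section Twisted.

Variables (n : nat) (w : 'I_n -> nat) (neg : nat -> bool) (L : rel 'I_n).
Hypotheses (L_tour : tournament L) (L_twisted : twisted w neg L).

Lemma twisted_iter j l k : j != l -> twins w j l ->
  L (iter k rotation j) (iter k rotation l)
  = L j l (+) odd (\sum_(i < k) neg (itinerary w j i)).
Proof.
move=> ne /twinsP same; elim: k => [|k IH]; first by rewrite big_ord0 addbF.
rewrite !iterS L_twisted ?(inj_eq (@iter_rotation_inj n k)) //.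
  by rewrite IH big_ord_recr /= oddD oddb addbA.
exact: same.
Qed.

(* The shift by the distance d between two twins is monotone on a class of
   twins, so the shift by 2d is increasing there, hence trivial. *)
Lemma twisted_antipodal : transitive L -> antipodal_twins w.
Proof.
move=> L_tr j l.
wlog lt_jl : j l / j < l => [wlog_lt ne tw|].
  have : (j < l) || (l < j) by rewrite -neq_ltn.
  case/orP => [|lt_lj]; first by move/wlog_lt; apply.
  rewrite addnC; apply: wlog_lt; rewrite // 1?eq_sym //.
  by apply/twinsP => k; rewrite (twinsP _ _ _ tw).
move=> _ /twinsP same; pose d := l - j.
have shift_d : iter d rotation j = l.
  by apply: iter_rotation_eq; rewrite /d subnKC // ltnW.
have itin_d k : itinerary w j (d + k) = itinerary w j k.
  by rewrite [RHS]same -shift_d itinerary_iter addnC.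
have [fix_2d|moved] := eqVneq (iter d.*2 rotation j) j.
  have := congr1 val fix_2d; rewrite /= val_iter_rotation => j_2d.
  have : j + d.*2 == j + 0 %[mod n] by rewrite j_2d addn0 modn_small.
  rewrite eqn_modDl mod0n => /dvdnP[[|[|q]]];
    by have := ltn_ord l; rewrite /d; lia.
pose x k := iter (k * d.*2) rotation j.
have tw_j : twins w j (iter d.*2 rotation j).
  by apply/twinsP => k; rewrite itinerary_iter addnC -addnn -addnA !itin_d.
have x_step k : L (x k) (x k.+1) = L j (iter d.*2 rotation j).
  rewrite {2}/x mulSnr iterD twisted_iter // 1?eq_sym // -doubleMr doubleMl.
  rewrite (sum_periodic (a := fun i => neg (itinerary w j i))) => [|i].
    by rewrite oddM odd_double addbF.
  by rewrite itin_d.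
have x_n : x n = j by apply: iter_rotation_eq; rewrite -modnDmr modnMr addn0.
have x_ne k : x k != x k.+1.
  by rewrite /x mulSnr iterD (inj_eq (@iter_rotation_inj _ _)) eq_sym.
have n_gt0 : 0 < n := leq_ltn_trans (leq0n j) (ltn_ord j).
have := monotone_walk_not_closed L_tour L_tr x_ne x_step n_gt0.
by rewrite x_n /x mul0n eqxx.
Qed.

Hypothesis L_letters : forall j l, w j < w l -> L j l.
Hypothesis w_antipodal : antipodal_twins w.

Let cyclic_triple (j l k : 'I_n) : bool :=
  [&& j != l, l != k, k != j, L j l == L l k & L l k == L k j].

Lemma cyclic_triple_letters j l k :
  cyclic_triple j l k -> w j = w l /\ w l = w k.
Proof.
have [_ L_tot] := L_tour; case/and5P=> ne_jl ne_lk ne_kj /eqP jl_lk /eqP lk_kj.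
have L_le x y : L x y -> x != y -> w x <= w y.
  move=> Lxy ne; rewrite leqNgt; apply: contraL Lxy => /L_letters Lyx.
  by rewrite L_tot 1?eq_sym // Lyx.
have L_ge x y : L x y = false -> x != y -> w y <= w x.
  by move=> Lxy ne; rewrite L_le // 1?eq_sym // L_tot ?Lxy.
case Lkj: (L k j) in lk_kj; rewrite lk_kj in jl_lk.
  have := L_le _ _ jl_lk ne_jl; have := L_le _ _ lk_kj ne_lk.
  by have := L_le _ _ Lkj ne_kj; lia.
have := L_ge _ _ jl_lk ne_jl; have := L_ge _ _ lk_kj ne_lk.
by have := L_ge _ _ Lkj ne_kj; lia.
Qed.

(* As long as three points carry the same letter, rotating them keeps or
   reverses all three comparisons, so a cyclic triple stays cyclic forever;
   but three points cannot share an itinerary. *)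
Lemma twisted_transitive : transitive L.
Proof.
have [L_irr L_tot] := L_tour.
have triple_rot j l k : cyclic_triple j l k ->
    cyclic_triple (rotation j) (rotation l) (rotation k).
  move=> jlk; have [w_jl w_lk] := cyclic_triple_letters jlk.
  case/and5P: jlk => ne_jl ne_lk ne_kj /eqP jl_lk /eqP lk_kj.
  rewrite /cyclic_triple !(inj_eq perm_inj) ne_jl ne_lk ne_kj.
  by rewrite !L_twisted // -?w_lk -?w_jl // jl_lk lk_kj !eqxx.
have no_triple j l k : ~~ cyclic_triple j l k.
  apply/negP => jlk.
  have triple i : cyclic_triple (iter i rotation j) (iter i rotation l)
                                (iter i rotation k).
    by elim: i => // i; apply: triple_rot.
  have letters i := cyclic_triple_letters (triple i).
  case/and5P: jlk => ne_jl ne_lk ne_kj _ _.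
  have /(w_antipodal ne_jl) : twins w j l.
    by apply/twinsP => i; case: (letters i).
  have /(w_antipodal ne_lk) : twins w l k.
    by apply/twinsP => i; case: (letters i).
  have /(w_antipodal ne_kj) : twins w k j.
    by apply/twinsP => i; case: (letters i) => jl lk; apply/esym/(etrans jl).
  by move: ne_jl ne_lk ne_kj; rewrite -!val_eqE /=; lia.
move=> l j k Ljl Llk; apply: contraT => nLjk.
have ne_jl : j != l by apply: contraTneq Ljl => ->; rewrite L_irr.
have ne_lk : l != k by apply: contraTneq Llk => ->; rewrite L_irr.
have ne_kj : k != j.
  by apply: contraTneq Llk => ->; rewrite L_tot // Ljl.
have Lkj : L k j by rewrite L_tot // eq_sym.
have := no_triple j l k.
by rewrite /cyclic_triple ne_jl ne_lk ne_kj Ljl Llk Lkj.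
Qed.

End Twisted.

(* Parity of the time at which the itineraries of j and l part. Twins get the
   parity of their position, which a rotation changes when n is even. *)
Definition part_parity n (w : 'I_n -> nat) (j l : 'I_n) : bool :=
  if [pick k : 'I_n | part_at w k j l] is Some k then odd k else odd j.

Lemma eq_part_parity n (w w' : 'I_n -> nat) j l :
  w =1 w' -> part_parity w j l = part_parity w' j l.
Proof.
move=> eq_w; have eq_part (k : 'I_n) : part_at w k j l = part_at w' k j l.
  rewrite /part_at /itinerary !eq_w; congr (_ && _).
  by apply: eq_forallb => i; rewrite !eq_w.
by rewrite /part_parity (eq_pick eq_part).
Qed.

Definition flip n (w : 'I_n -> nat) (L : rel 'I_n) : rel 'I_n :=
  fun j l => (j != l) && (L j l (+) part_parity w j l).

Section Flip.

Variables (n : nat) (w : 'I_n -> nat).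

Lemma part_parity_part k j l : part_at w k j l -> part_parity w j l = odd k.
Proof.
move=> part_k; rewrite /part_parity; case: pickP => [k' | no_part].
  by move/(part_at_uniq part_k)->.
have [tw|[k' part_k']] := twins_or_part w j l.
  by rewrite (negPf (twins_not_part k tw)) in part_k.
by rewrite no_part in part_k'.
Qed.

Lemma part_parity_twins j l : twins w j l -> part_parity w j l = odd j.
Proof.
move=> tw; rewrite /part_parity; case: pickP => // k.
by rewrite (negPf (twins_not_part k tw)).
Qed.

Hypothesis n_mod4 : n %% 4 != 2.
Hypothesis w_antipodal : antipodal_twins w.

Lemma part_parityC j l : j != l -> part_parity w j l = part_parity w l j.
Proof.
move=> ne; have [tw|[k part_k]] := twins_or_part w j l.
  have tw' : twins w l j by apply/twinsP => k; rewrite (twinsP _ _ _ tw).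
  rewrite !part_parity_twins //.
  by have := w_antipodal ne tw; lia.
by rewrite (part_parity_part part_k) (part_parity_part (k := k)) // part_atC.
Qed.

Lemma part_parity_rotation j l : j != l -> w j = w l ->
  part_parity w (rotation j) (rotation l) = ~~ part_parity w j l.
Proof.
move=> ne eq_w; have [tw|[[k lt_kn] /= part_k]] := twins_or_part w j l.
  rewrite !part_parity_twins ?twins_rotation //.
  have n_even : odd n = false by rewrite (w_antipodal ne tw) odd_double.
  by rewrite permE /= [in RHS](_ : odd j = ~~ odd j.+1) ?negbK //
             [in RHS](divn_eq j.+1 n) oddD oddM n_even andbF.
case: k => [|k] in lt_kn part_k *.
  by case/part_atP: part_k => /(_ eq_w).
rewrite (part_parity_part part_k) (part_parity_part (k := k)) ?negbK //.
by rewrite part_at_rotation.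
Qed.

Variables (neg : nat -> bool) (L : rel 'I_n).

Lemma flip_tournament : tournament L -> tournament (flip w L).
Proof.
move=> [_ L_tot]; split=> [j | j l ne]; first by rewrite /flip eqxx.
by rewrite /flip eq_sym ne /= L_tot // -part_parityC // addNb.
Qed.

Lemma flip_twisted : twisted w neg L -> twisted w (negb \o neg) (flip w L).
Proof.
move=> L_twisted j l ne eq_w.
rewrite /flip (inj_eq perm_inj) ne /= L_twisted // part_parity_rotation //.
by rewrite /= !addbN addbAC.
Qed.

Lemma flip_letters :
  (forall j l, w j < w l -> L j l) -> forall j l, w j < w l -> flip w L j l.
Proof.
move=> L_letters j l lt_w; have ne : j != l.
  by apply: contraTneq lt_w => ->; rewrite ltnn.
have part0 : part_at w 0 j l.
  by apply/part_atP; split=> // eq_w; move: lt_w; rewrite [w j]eq_w ltnn.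
by rewrite /flip ne L_letters ?(part_parity_part part0).
Qed.

End Flip.

(** * Cyclic permutations as conjugates of the rotation *)

Lemma cyclicpP n (s : 'S_n) x :
  reflect (forall y, y \in porbit s x) (cyclicp s).
Proof.
apply: (iffP cards1P) => [[A orbitsA] y | orbit_x].
  have orbitA z : porbit s z = A by apply/set1P; rewrite -orbitsA imset_f.
  by rewrite porbit_sym -eq_porbit_mem !orbitA.
exists (porbit s x); apply/setP => A; rewrite inE.
apply/imsetP/eqP => [[y _ ->]|->]; last by exists x.
by apply/eqP; rewrite eq_porbit_mem.
Qed.

Lemma cyclicp_conj_rotation n (s : 'S_n.+1) :
  reflect (exists r, s = rotation ^ r)%g (cyclicp s).
Proof.
apply: (iffP idP) => [/(cyclicpP s ord0) orbit0 | [r ->]]; last first.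
  apply/(cyclicpP _ (r ord0)) => y.
  have [k rot_k] := iter_rotation_trans ord0 (r^-1 y)%g.
  by apply/porbitP; exists k; rewrite -conjXg permJ permX rot_k permKV.
have card_orbit : #|porbit s ord0| = n.+1.
  by rewrite -[RHS]card_ord; apply: eq_card => y; rewrite orbit0.
pose g (j : 'I_n.+1) := iter j s ord0.
have g_inj : injective g.
  move=> j l eq_g; have := uniq_traject_porbit s ord0.
  rewrite card_orbit => /uniqP-/(_ ord0 j l); rewrite !inE size_traject.
  by rewrite !nth_traject // => inj; apply/val_inj/inj.
exists (perm g_inj); apply/permP => y.
rewrite -[y](permKV (perm g_inj)) permJ; move: ((perm g_inj)^-1%g y) => j.
rewrite !permE /g /=; have [lt|le] := ltnP j n; first by rewrite modn_small.
have -> : val j = n by apply/eqP; rewrite eqn_leq le -ltnS ltn_ord.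
by rewrite modnn -iterS -[X in iter X]card_orbit iter_porbit.
Qed.

Lemma cyclicpJ n (s r : 'S_n.+1) : cyclicp (s ^ r)%g = cyclicp s.
Proof.
apply/cyclicp_conj_rotation/cyclicp_conj_rotation => -[t].
  by exists (t * r^-1)%g; rewrite conjgM; apply/(canRL (conjgK r)).
by move->; exists (t * r)%g; rewrite conjgM.
Qed.

Lemma cyclicp_involution m (s : 'S_m.+1) : cyclicp s -> (s * s = 1)%g -> m <= 1.
Proof.
move=> /(cyclicpP s ord0) orbit0 ss1; rewrite -ltnS -[m.+1]card_ord.
have -> : #|'I_m.+1| = #|porbit s ord0| by apply: eq_card => i; rewrite orbit0.
rewrite porbit.unlock; apply: leq_trans (leq_imset_card _ _) _.
apply: dvdn_leq => //.
by rewrite -/#[s]%g order_dvdn expgS expg1 ss1.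
Qed.

Lemma card_conj_rotation n (P : pred 'S_n.+1) :
  #|[set r | P (rotation ^ r)%g]|
  = #|[set s | cyclicp s && P s]| * #|'C[@rotation n.+1]%g|.
Proof.
rewrite -sum1_card (partition_big (conjg rotation)
  [in [set s | cyclicp s && P s]]) => [|r] /=; last first.
  by rewrite !inE => ->; rewrite andbT; apply/cyclicp_conj_rotation; exists r.
rewrite -sum_nat_const; apply: eq_bigr => s; rewrite inE => /andP[].
move=> /cyclicp_conj_rotation[t ->] Pt; rewrite sum1_card -(card_rcoset _ t).
apply: eq_card => r; rewrite mem_rcoset unfold_in /= inE.
have <- : (rotation ^ r == rotation ^ t)%g = (r * t^-1 \in 'C[rotation])%g.
  rewrite -(inj_eq (conjg_inj t^-1)%g) conjgK -conjgM (sameP eqP conjg_fixP).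
  by apply/commgP/cent1P => /commute_sym.
by have [->|_] := eqVneq; rewrite ?Pt // andbF.
Qed.

Definition monotone_on_fibers n (f : nat -> nat) (neg : nat -> bool)
    (s : 'S_n) : bool :=
  [forall i : 'I_n, forall j : 'I_n,
    (i != j) && (f i == f j) ==> ((s i < s j) == (i < j) (+) neg (f i))].

Lemma monotone_on_fibersP n (f : nat -> nat) neg (s : 'S_n) :
  reflect (forall i j : 'I_n, i != j -> f i = f j ->
             (s i < s j) = (i < j) (+) neg (f i))
          (monotone_on_fibers f neg s).
Proof.
apply: (iffP forallP) => [mono i j ne /eqP eq_f | mono i].
  by have /forallP/(_ j) := mono i; rewrite ne eq_f => /eqP.
by apply/forallP => j; apply/implyP => /andP[ne /eqP eq_f]; rewrite mono.
Qed.

Lemma monotone_conj_rotation n (f : nat -> nat) neg (r : 'S_n) :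
  reflect (twisted (fun j => f (r j)) neg (fun j l => r j < r l))
          (monotone_on_fibers f neg (rotation ^ r)%g).
Proof.
apply: (iffP (monotone_on_fibersP _ _ _)) => [mono j l ne eq_f | tw i j].
  by rewrite -!(permJ rotation r) mono // (inj_eq perm_inj).
rewrite -[i](permKV r) -[j](permKV r); move: (r^-1%g i) (r^-1%g j) => k l.
by rewrite (inj_eq perm_inj) !permJ; apply: tw.
Qed.

Section FlipSigns.

Variables (n : nat) (f : nat -> nat).
Hypotheses (f_homo : {homo f : i j / i <= j}) (n_mod4 : n %% 4 != 2).

Definition flipped (r r' : 'S_n) : Prop :=
  (forall j, f (r' j) = f (r j)) /\
  forall j l,
    (r' j < r' l) = flip (fun j => f (r j)) (fun j l => r j < r l) j l.

Lemma exists_flipped neg (r : 'S_n) :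
    monotone_on_fibers f neg (rotation ^ r)%g ->
  exists2 r' : 'S_n, monotone_on_fibers f (negb \o neg) (rotation ^ r')%g
                   & flipped r r'.
Proof.
pose w j := f (r j); pose L j l := r j < r l.
move/monotone_conj_rotation => tw_r; have tour_r := ltn_perm_tournament r.
have letters_r j l : w j < w l -> L j l.
  move=> lt_w; rewrite /L ltnNge; apply: contraL lt_w => le_lj.
  by rewrite -leqNgt f_homo.
have antip : antipodal_twins w.
  apply: twisted_antipodal tour_r tw_r _ => k j l; exact: ltn_trans.
have tour := flip_tournament n_mod4 antip tour_r.
have tw := flip_twisted antip tw_r.
have letters := flip_letters letters_r.
have trans := twisted_transitive tour tw letters antip.
have [r' r'E] := perm_of_tournament tour trans.
have eq_f j : f (r' j) = f (r j).
  have := homo_comp_perm (q := r'^-1 * r) f_homo _ (r' j).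
  rewrite permM permK => -> // i l le_il; rewrite !permM leqNgt.
  by apply/negP => /letters; rewrite -r'E !permKV ltnNge le_il.
exists r' => //; apply/monotone_conj_rotation => j l ne.
by rewrite !eq_f !r'E; apply: tw.
Qed.

Lemma leq_card_flip_conj_rotation neg :
  #|[set r : 'S_n | monotone_on_fibers f neg (rotation ^ r)%g]|
  <= #|[set r : 'S_n | monotone_on_fibers f (negb \o neg) (rotation ^ r)%g]|.
Proof.
have ex_flip (r : 'S_n) : exists r' : 'S_n,
    monotone_on_fibers f neg (rotation ^ r)%g ->
    monotone_on_fibers f (negb \o neg) (rotation ^ r')%g /\ flipped r r'.
  case: (boolP (monotone_on_fibers f neg (rotation ^ r)%g)); last by exists r.
  by move/exists_flipped=> [r' mono flip_r]; exists r'.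
have [F F_flip] := fin_all_exists ex_flip.
rewrite -(card_in_imset (f := F)) => [|r1 r2]; last first.
  rewrite !inE => /F_flip[_ [f1 lt1]] /F_flip[_ [f2 lt2]] eqF.
  apply: eq_perm_ltn => j l; have := lt1 j l; rewrite eqF lt2 /flip.
  have [->|ne /=] := eqVneq j l; first by rewrite !ltnn.
  have eq_w i : f (r2 i) = f (r1 i) by rewrite -f1 -f2 eqF.
  by rewrite (eq_part_parity j l eq_w) => /addIb.
apply/subset_leq_card/subsetP => _ /imsetP[r r_in ->].
by move: r_in; rewrite !inE => /F_flip[].
Qed.

End FlipSigns.

Lemma card_cyclic_monotone_flip n (f : nat -> nat) neg :
    {homo f : i j / i <= j} -> n.+1 %% 4 != 2 ->
  #|[set s : 'S_n.+1 | cyclicp s && monotone_on_fibers f neg s]|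
  = #|[set s : 'S_n.+1 | cyclicp s && monotone_on_fibers f (negb \o neg) s]|.
Proof.
move=> f_homo n_mod4; apply/eqP.
rewrite -(eqn_pmul2r (cardG_gt0 'C[@rotation n.+1])) -!card_conj_rotation.
rewrite eqn_leq leq_card_flip_conj_rotation //=.
apply: leq_trans (leq_card_flip_conj_rotation _ _ _) _ => //.
apply/subset_leq_card/subsetP => r; rewrite !inE => /monotone_on_fibersP mono.
by apply/monotone_on_fibersP => i j ne eq_f; rewrite mono //= negbK.
Qed.

(** * Descents and segments *)

Definition desc m (s : 'S_m.+1) (i : nat) : bool :=
  s (inord i.+1) < s (inord i).

Definition descents_fit m (f : nat -> nat) (neg D : nat -> bool) : bool :=
  [forall i : 'I_m, (f i == f i.+1) ==> (D i == neg (f i))].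

Lemma descents_fitP m f neg D :
  reflect (forall i, i < m -> f i = f i.+1 -> D i = neg (f i))
          (descents_fit m f neg D).
Proof.
apply: (iffP forallP) => [fit i lt_im eq_f | fit i].
  by apply/eqP/(implyP (fit (Ordinal lt_im)))/eqP.
by apply/implyP => /eqP eq_f; apply/eqP/fit.
Qed.

Section Descents.

Variables (m : nat) (s : 'S_m.+1).

Let inord_neq_succ i : i < m -> inord i != inord i.+1 :> 'I_m.+1.
Proof.
move=> lt_im; apply/eqP => /(congr1 val)/=.
by rewrite !inordK ?ltnS ?(ltnW lt_im) // => /n_Sn.
Qed.

Lemma ltn_perm_succ i : i < m ->
  (s (inord i) < s (inord i.+1)) = ~~ desc s i.
Proof.
move=> lt_im; have [_ -> //] := ltn_perm_tournament s.
by rewrite eq_sym inord_neq_succ.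
Qed.

Lemma ltn_perm_fiber f neg (k l : 'I_m.+1) : {homo f : i j / i <= j} ->
    descents_fit m f neg (desc s) -> k < l -> f k = f l ->
  (s k < s l) = ~~ neg (f k).
Proof.
move=> f_homo /descents_fitP fit lt_kl eq_f.
pose lt_s a b := (if neg (f k) then b < a else a < b) : bool.
have lt_s_tr a b c : lt_s b a -> lt_s a c -> lt_s b c.
  by rewrite /lt_s; case: (neg _); [move=> /[swap] |]; apply: ltn_trans.
have : lt_s (s (inord k)) (s (inord l)).
  pose D := [pred x | (x <= m) && (f x == f k)].
  apply: (homo_ltn_in (D := D) (f := fun x => s (inord x)) lt_s_tr) => //.
  - move=> x y; rewrite !inE => /andP[_ /eqP fx] /andP[le_y /eqP fy] z.
    case/andP=> lt_xz lt_zy; rewrite inE (leq_trans (ltnW lt_zy) le_y) /=.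
    by rewrite eqn_leq -{1}fy -fx !f_homo // ltnW.
  - move=> x; rewrite !inE => /andP[_ /eqP fx] /andP[lt_xm /eqP fSx].
    have := fit x lt_xm; rewrite fx fSx => /(_ erefl); rewrite /lt_s => <-.
    by case desc_x: (desc s x); rewrite // ltn_perm_succ ?desc_x.
  - by rewrite inE eqxx -ltnS ltn_ord.
  - by rewrite inE -eq_f eqxx -ltnS ltn_ord.
by rewrite !inord_val /lt_s; case: (neg _) => // lt_s_lk; rewrite ltnNge ltnW.
Qed.

Lemma monotone_on_fibers_desc f neg : {homo f : i j / i <= j} ->
  monotone_on_fibers f neg s = descents_fit m f neg (desc s).
Proof.
move=> f_homo; apply/monotone_on_fibersP/idP => [mono | fit i j ne eq_f].
  apply/descents_fitP => i lt_im eq_f; apply: negb_inj.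
  rewrite -ltn_perm_succ // mono ?inord_neq_succ //.
    by rewrite !inordK ?ltnS ?leqnn ?(ltnW lt_im).
  by rewrite !inordK ?ltnS ?(ltnW lt_im).
case: (ltngtP i j) => [lt_ij | lt_ji | /val_inj eq_ij].
- exact: ltn_perm_fiber fit lt_ij eq_f.
- have [_ ->] := ltn_perm_tournament s; last by rewrite eq_sym.
  by rewrite (ltn_perm_fiber f_homo fit lt_ji) // negbK eq_f.
by rewrite eq_ij eqxx in ne.
Qed.

End Descents.

Lemma desc_const_involution m (s : 'S_m.+1) b :
  (forall i, i < m -> desc s i = b) -> (s * s = 1)%g.
Proof.
move=> desc_b; have : monotone_on_fibers (fun=> 0) (fun=> b) s.
  by rewrite monotone_on_fibers_desc //; apply/descents_fitP => i /desc_b.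
move/monotone_on_fibersP => mono; apply: eq_perm_ltn => i j.
rewrite !permM !perm1.
have [->|ne] := eqVneq i j; first by rewrite !ltnn.
by rewrite !mono ?(inj_eq perm_inj) // -addbA addbb addbF.
Qed.

Lemma cyclicp_exists_desc m (s : 'S_m.+1) : cyclicp s -> m != 1 ->
  [exists i : 'I_m, desc s i] = [exists i : 'I_m, ~~ desc s i].
Proof.
move=> cyc_s m_neq1.
have m_eq0 b : (forall i, i < m -> desc s i = b) -> m = 0.
  by move/desc_const_involution/(cyclicp_involution cyc_s); lia.
have empty (P : pred 'I_m) : m = 0 -> [exists i, P i] = false.
  by move=> m0; apply/existsP => -[i _]; move: (ltn_ord i); lia.
apply/idP/idP; apply: contraTT; rewrite negb_exists => /forallP const.
  rewrite empty //; apply: (m_eq0 true) => i lt_im.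
  by rewrite -[LHS]negbK (const (Ordinal lt_im)).
rewrite empty //; apply: (m_eq0 false) => i lt_im.
exact/negbTE/(const (Ordinal lt_im)).
Qed.

Definition reversal n : 'S_n := perm (@rev_ord_inj n).

Lemma desc_conj_reversal m (s : 'S_m.+1) i : i < m ->
  desc (s ^ reversal m.+1)%g i = desc s (m - i.+1).
Proof.
move=> lt_im; have conjE k : k <= m ->
    (s ^ reversal m.+1)%g (inord k) = m - s (inord (m - k)) :> nat.
  move=> le_km; have -> : inord k = reversal m.+1 (inord (m - k)).
    by apply: val_inj; rewrite permE /= !inordK ?ltnS ?leq_subr // subSS subKn.
  by rewrite permJ permE /= subSS.
rewrite /desc !conjE //; last exact: ltnW.
have -> : (m - i.+1).+1 = m - i by lia.
move: (ltn_ord (s (inord (m - i)))) (ltn_ord (s (inord (m - i.+1)))); lia.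
Qed.

(* The index of the block containing position i, when the cuts c delimit
   size c + 1 consecutive blocks. *)
Definition block (c : seq nat) (i : nat) : nat := count (fun e => e <= i) c.

Lemma block_homo c : {homo block c : i j / i <= j}.
Proof. by move=> i j le_ij; apply: sub_count => e /leq_trans; apply. Qed.

Definition mirror_cuts n (c : seq nat) : seq nat := rev [seq n - e | e <- c].

Lemma block_mirror_cuts m c i : all (fun e => e <= m.+1) c -> i <= m ->
  block (mirror_cuts m.+1 c) i = size c - block c (m - i).
Proof.
move=> /allP le_c le_im; rewrite /block count_rev count_map.
rewrite -(count_predC (fun e => e <= m - i)) addKn.
by apply: eq_in_count => e /le_c /=; lia.
Qed.

Lemma descents_fit_mirror m c neg D : all (fun e => e <= m.+1) c ->
  descents_fit m (block (mirror_cuts m.+1 c)) (fun a => neg (size c - a))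
                 (fun i => D (m - i.+1))
  = descents_fit m (block c) neg D.
Proof.
move=> le_c; have blockK i : size c - (size c - block c i) = block c i.
  by apply/subKn/count_size.
apply/descents_fitP/descents_fitP => fit i lt_im.
  have [i_mirror Si_mirror] : m - (m - i.+1).+1 = i /\ m - (m - i.+1) = i.+1.
    by lia.
  move=> eq_b; have := fit (m - i.+1).
  rewrite !block_mirror_cuts ?i_mirror ?Si_mirror; try lia.
  by rewrite blockK eq_b; apply=> //; lia.
have Sm_i : (m - i.+1).+1 = m - i by lia.
rewrite !block_mirror_cuts ?blockK //; last exact: ltnW.
move/(congr1 (subn (size c))); rewrite !blockK => eq_b.
by rewrite eq_b fit ?Sm_i //; lia.
Qed.

Lemma eq_descents_fit m f neg neg' D D' :
    (forall i, i < m -> (D i == neg (f i)) = (D' i == neg' (f i))) ->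
  descents_fit m f neg D = descents_fit m f neg' D'.
Proof. by move=> eq_fit; apply: eq_forallb => i; rewrite eq_fit. Qed.

Definition is_minus (sigma : signature) (a : nat) : bool := ~~ nth true sigma a.

Definition opposite (sigma : signature) : signature := map negb (rev sigma).

Lemma is_minus_opposite sigma a : a < size sigma ->
  is_minus (opposite sigma) a = ~~ is_minus sigma (size sigma - a.+1).
Proof. by move=> lt_a; rewrite /is_minus (nth_map true) ?size_rev ?nth_rev. Qed.

Definition cuts_fit (sigma : signature) (c : seq nat) m (D : nat -> bool) :
    bool :=
  descents_fit m (block c) (is_minus sigma) D.

Definition opposite_desc m (D : nat -> bool) (i : nat) : bool :=
  ~~ D (m - i.+1).

Lemma cuts_fit_opposite sigma c m D :
    all (fun e => e <= m.+1) c -> size sigma = (size c).+1 ->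
  cuts_fit (opposite sigma) (mirror_cuts m.+1 c) m (opposite_desc m D)
  = cuts_fit sigma c m D.
Proof.
move=> le_c size_sigma; rewrite /cuts_fit -[RHS]descents_fit_mirror //.
apply: eq_descents_fit => i lt_im; rewrite block_mirror_cuts ?(ltnW lt_im) //.
rewrite is_minus_opposite size_sigma ?ltnS ?leq_subr // subSS.
by rewrite (inj_eq negb_inj).
Qed.

Lemma card_cyclic_opposite sigma c m :
    m.+1 %% 4 != 2 -> all (fun e => e <= m.+1) c -> size sigma = (size c).+1 ->
  #|[set s : 'S_m.+1 | cyclicp s && cuts_fit sigma c m (desc s)]|
  = #|[set s : 'S_m.+1 | cyclicp s &&
         cuts_fit (opposite sigma) (mirror_cuts m.+1 c) m (desc s)]|.
Proof.
move=> n_mod4 le_c size_sigma; have homo_c := @block_homo c.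
under eq_finset => s do rewrite /cuts_fit -monotone_on_fibers_desc //.
rewrite card_cyclic_monotone_flip //.
rewrite -[RHS](card_preimset _ (@conjg_inj _ (reversal m.+1))).
apply: eq_card => s; rewrite !inE cyclicpJ monotone_on_fibers_desc //.
rewrite -[X in _ && X]descents_fit_mirror //; congr (_ && _).
apply: eq_descents_fit => i lt_im; rewrite desc_conj_reversal //.
rewrite block_mirror_cuts ?(ltnW lt_im) //.
rewrite is_minus_opposite size_sigma ?subSS //.
by rewrite ltnS leq_subr.
Qed.

Lemma eq_block_succ c i : (block c i == block c i.+1) = (i.+1 \notin c).
Proof.
have -> : block c i.+1 = block c i + count_mem i.+1 c.
  by rewrite /block; elim: c => //= e c ->; lia.
by rewrite -{1}[block c i]addn0 eqn_add2l eq_sym; apply/eqP/count_memPn.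
Qed.

Lemma cuts_fitP sigma c m D :
  reflect (forall i, i < m -> i.+1 \notin c -> D i = is_minus sigma (block c i))
          (cuts_fit sigma c m D).
Proof.
apply: (iffP (descents_fitP _ _ _ _)) => fit i lt_im.
  by rewrite -eq_block_succ => /eqP; apply: fit.
by move/eqP; rewrite eq_block_succ; apply: fit.
Qed.

(** * Counting cuts *)

Lemma card_set_sum (T : finType) (P : pred T) : #|[set x | P x]| = \sum_x P x.
Proof. by rewrite -sum1dep_card big_mkcond. Qed.

Lemma card_pairs_snd (T U : finType) (A : {set T * U}) :
  #|A| = \sum_y #|[set x | (x, y) \in A]|.
Proof.
rewrite -sum1_card big_mkcond /= (eq_bigr (fun p => (p.1, p.2) \in A : nat)).
  rewrite -(pair_bigA _ (fun x y => (x, y) \in A : nat)) exchange_big /=.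
  by apply: eq_bigr => y _; rewrite card_set_sum.
by case=> x y _; case: (_ \in A).
Qed.

Lemma sum_exchange_card (T U : finType) (P : pred T) (F : T -> {set U})
    (g : U -> nat) :
  \sum_(x | P x) \sum_(y in F x) g y
  = \sum_y #|[set x | P x && (y \in F x)]| * g y.
Proof.
rewrite (exchange_big_dep xpredT) //=; apply: eq_bigr => y _.
by rewrite -sum_nat_const; apply: eq_bigl => x; rewrite inE.
Qed.

Lemma sum_nat_interval n l u : \sum_(e < n) (l <= e < u) = minn n u - l.
Proof.
elim: n => [|n IH]; first by rewrite big_ord0; lia.
by rewrite big_ord_recr /= IH; lia.
Qed.

Local Notation pm := [:: true; false].
Local Notation ppm := [:: true; true; false].
Local Notation pmm := [:: true; false; false].

Definition cut_pairs (sigma : signature) m (D : nat -> bool) :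
    {set 'I_m.+2 * 'I_m.+2} :=
  [set e : 'I_m.+2 * 'I_m.+2 | (e.1 <= e.2)
           && cuts_fit sigma [:: e.1 : nat; e.2 : nat] m D].

Definition peaks m (D : nat -> bool) : {set 'I_m.+2} :=
  [set e : 'I_m.+2 | cuts_fit pm [:: e : nat] m D].

(* The first e letters have e.-1 adjacent pairs. *)
Definition ndesc (D : nat -> bool) (e : nat) : nat := \sum_(i < e.-1) D i.

Definition descends_from m (D : nat -> bool) (e : nat) : bool :=
  [forall i : 'I_m, (e <= i) ==> D i].

Lemma descends_fromP m (D : nat -> bool) e :
  reflect (forall i, e <= i -> i < m -> D i) (descends_from m D e).
Proof.
apply: (iffP forallP) => [desc_D i le_ei lt_im | desc_D i].
  exact: (implyP (desc_D (Ordinal lt_im))).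
by apply/implyP => le_ei; apply: desc_D.
Qed.

Lemma ndesc_eq0 (D : nat -> bool) e :
  (ndesc D e == 0) = [forall i : 'I_e.-1, ~~ D i].
Proof. by rewrite sum_nat_eq0; apply: eq_forallb => i; rewrite eqb0. Qed.

(* The last descending run starts at b. As the pair before it, if any, is an
   ascent, the first b + 1 letters have no more descents than the first b. *)
Lemma last_descending_run m (D : nat -> bool) : exists2 b, b <= m &
  forall e, e <= m.+1 -> (descends_from m D e = (b <= e))
    /\ (b <= e -> ndesc D e = ndesc D b + (e - b.+1)).
Proof.
have from_m : descends_from m D m by apply/descends_fromP; lia.
have run_exists : exists e, descends_from m D e by exists m.
have [b b_run b_min] := ex_minnP run_exists.
move/descends_fromP in b_run; exists b; first exact: b_min.
move=> e le_e; split.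
  apply/idP/idP => [/b_min // | le_be]; apply/descends_fromP => i le_ei.
  exact: b_run (leq_trans le_be le_ei).
have ndescS k : ndesc D k.+2 = ndesc D k.+1 + D k.
  by rewrite /ndesc big_ord_recr.
elim: e le_e => [|e IH] le_e; first by rewrite leqn0 => /eqP->; rewrite addn0.
rewrite leq_eqVlt => /predU1P[<-|lt_be]; first by rewrite subnS subnn addn0.
rewrite subSS; case: e => [|e] in IH le_e lt_be *.
  by move: lt_be; rewrite ltnS leqn0 => /eqP->; rewrite /ndesc !big_ord0.
rewrite ndescS IH ?subSS; [|exact: ltnW|exact: lt_be].
have [eq_b|ne_b] := eqVneq b e.+1; last first.
  by rewrite b_run; lia.
suff /negPf-> : ~~ D e by lia.
apply: contraL (ltnSn e) => De; rewrite -leqNgt -eq_b; apply: b_min.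
apply/descends_fromP => i; rewrite leq_eqVlt => /predU1P[<- // | lt_ei].
by apply: b_run; rewrite eq_b.
Qed.

Lemma is_minus_block_pm e i : is_minus pm (block [:: e] i) = (e <= i).
Proof. by rewrite /block /=; case: (e <= i). Qed.

Lemma is_minus_block_ppm e1 e2 i : e1 <= e2 ->
  is_minus ppm (block [:: e1; e2] i) = (e2 <= i).
Proof.
move=> le_e; rewrite /block /=; have [le_ei|_] := leqP e2 i; last by case: leqP.
by rewrite (leq_trans le_e).
Qed.

Lemma cuts_fit_pm m D e : e <= m.+1 ->
  cuts_fit pm [:: e] m D = descends_from m D e && (ndesc D e == 0).
Proof.
move=> le_e; rewrite ndesc_eq0.
apply/cuts_fitP/andP=> [fit | [/descends_fromP run /forallP rise] i lt_im].
  split; first apply/descends_fromP => i le_ei lt_im.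
    by rewrite fit ?inE ?is_minus_block_pm; lia.
  apply/forallP => i; have lt_i := ltn_ord i.
  by rewrite fit ?inE ?is_minus_block_pm; lia.
rewrite inE is_minus_block_pm => ne_e.
case: leqP => [|lt_ie]; first by move/run->.
have lt_i : i < e.-1 by lia.
exact/negbTE/(rise (Ordinal lt_i)).
Qed.

Lemma cuts_fit_ppm m D e1 e2 : e1 <= e2 -> e2 <= m.+1 ->
  cuts_fit ppm [:: e1; e2] m D
  = descends_from m D e2 && [forall i : 'I_e2.-1, D i ==> (i.+1 == e1)].
Proof.
move=> le_e12 le_e2.
apply/cuts_fitP/andP=> [fit | [/descends_fromP run /forallP rise] i lt_im].
  split; first apply/descends_fromP => i le_ei lt_im.
    by rewrite fit ?inE ?is_minus_block_ppm; lia.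
  apply/forallP => i; apply/implyP; apply: contraTT => ne_e1.
  have lt_i := ltn_ord i.
  by rewrite fit ?inE ?is_minus_block_ppm ?(negPf ne_e1); lia.
rewrite !inE negb_or is_minus_block_ppm // => /andP[ne_e1 ne_e2].
case: leqP => [|lt_ie]; first by move/run->.
have lt_i : i < e2.-1 by lia.
by apply: contraNF ne_e1; apply: (implyP (rise (Ordinal lt_i))).
Qed.

Lemma card_first_cuts n (D : nat -> bool) e : e < n ->
  #|[set e1 : 'I_n | (e1 <= e) && [forall i : 'I_e.-1, D i ==> (i.+1 == e1)]]|
  = e * (ndesc D e == 0) + (ndesc D e <= 1).
Proof.
move=> lt_en; rewrite /ndesc -card_set_sum.
have [desc0 | [i]] := set_0Vmem [set i : 'I_e.-1 | D i].
  rewrite desc0 cards0 eqxx muln1 addn1 -[RHS](@card_ltn_ord n) //.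
  apply: eq_card => e1; rewrite !inE ltnS andb_idr // => _.
  by apply/forallP => i; have /setP/(_ i) := desc0; rewrite !inE => ->.
move=> desc_i; have desc_gt0 : 0 < #|[set i : 'I_e.-1 | D i]|.
  by apply/card_gt0P; exists i.
rewrite (gtn_eqF desc_gt0) muln0 add0n inE in desc_i *.
have lt_in : i.+1 < n by have := ltn_ord i; lia.
have [/card_le1_eqP desc1 | /card_gt1P[j [k []]]] := leqP.
  rewrite -[RHS](cards1 (Ordinal lt_in)); apply: eq_card => e1; rewrite !inE.
  rewrite -val_eqE /= eq_sym; apply/andP/eqP => [[_ /forallP/(_ i)] | <-].
    by rewrite desc_i => /eqP.
  split; first by have := ltn_ord i; lia.
  apply/forallP => j; apply/implyP => desc_j.
  by rewrite (desc1 i j) ?inE.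
rewrite !inE => desc_j desc_k ne_jk; apply: eq_card0 => e1; rewrite !inE.
apply: contraNF ne_jk => /andP[_ /forallP first].
have := first j; have := first k; rewrite desc_j desc_k /= => /eqP eq_k.
by rewrite -eq_k eqSS.
Qed.

Lemma card_cut_pairs_snd m D (e2 : 'I_m.+2) :
  #|[set e1 : 'I_m.+2 | (e1, e2) \in cut_pairs ppm m D]|
  = descends_from m D e2 * (e2 * (ndesc D e2 == 0) + (ndesc D e2 <= 1)).
Proof.
rewrite -(card_first_cuts D (ltn_ord e2)).
have fitE (e1 : 'I_m.+2) : ((e1, e2) \in cut_pairs ppm m D)
    = (e1 <= e2) && (descends_from m D e2
        && [forall i : 'I_e2.-1, D i ==> (i.+1 == e1)]).
  by rewrite inE; case: leqP => //= le_e12; rewrite cuts_fit_ppm // leq_ord.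
case: descends_from fitE => fitE.
  by rewrite mul1n; apply: eq_card => e1; rewrite [LHS]inE fitE inE.
by apply: eq_card0 => e1; rewrite inE fitE andbF.
Qed.

(* Let b be the start of the last descending run. If there are pairs of cuts
   at all, then e2 takes the values b, b + 1, and also b + 2 when D is unimodal
   and not increasing. Each e2 allows a single e1, plus e2 more at a peak. *)
Lemma card_cut_pairs_ppm m D :
  #|cut_pairs ppm m D|
  = 2 * (cut_pairs ppm m D != set0)
    + \sum_(e in peaks m D) e
    + ((peaks m D != set0) && [exists i : 'I_m, D i]).
Proof.
have [b le_bm run_b] := last_descending_run m D; set d := ndesc D b in run_b.
have peaksE (e : 'I_m.+2) :
    (e \in peaks m D) = (b <= e) && (d + (e - b.+1) == 0).
  rewrite inE cuts_fit_pm ?leq_ord //.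
  have [-> ndescE] := run_b e (leq_ord e).
  by case: leqP ndescE => // _ ->.
have countE : #|cut_pairs ppm m D|
    = \sum_(e in peaks m D) e + (2 * (d <= 1) + ((d == 0) && (b < m))).
  rewrite card_pairs_snd.
  transitivity (\sum_(e : 'I_m.+2) ((if e \in peaks m D then e : nat else 0)
                                    + (d <= 1) * (b <= e < b + 3 - d))).
    apply: eq_bigr => e _; rewrite card_cut_pairs_snd peaksE.
    have [-> ndescE] := run_b e (leq_ord e).
    case: (leqP b e) ndescE => [le_be /(_ isT)-> | _ _]; last by rewrite muln0.
    by case: eqVneq => /=; lia.
  rewrite big_split -big_mkcond -big_distrr sum_nat_interval /=.
  by congr (_ + _); case: (leqP d 1) => /=; lia.
have someE : [exists i : 'I_m, D i] = (d + (m.+1 - b.+1) != 0).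
  have [_ <- //] := run_b m.+1 (leqnn _); last exact: leqW.
  by rewrite ndesc_eq0 negb_forall; apply: eq_existsb => i; rewrite negbK.
have peaks_neq0 : (peaks m D != set0) = (d == 0).
  apply/set0Pn/eqP => [[e] | d0]; first by rewrite peaksE; lia.
  by exists (inord b); rewrite peaksE inordK; lia.
have pairs_neq0 : (cut_pairs ppm m D != set0) = (d <= 1).
  rewrite -card_gt0 countE; case: (leqP d 1) => [|d_gt1]; first by lia.
  rewrite big1 => [|e]; first by lia.
  by rewrite peaksE; lia.
rewrite countE someE peaks_neq0 pairs_neq0; lia.
Qed.

Definition mirror_pair n (e : 'I_n * 'I_n) : 'I_n * 'I_n :=
  (rev_ord e.2, rev_ord e.1).

Lemma mirror_pairK n : involutive (@mirror_pair n).
Proof. by case=> e1 e2; rewrite /mirror_pair !rev_ordK. Qed.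

Lemma cut_pairs_mirror sigma m D : size sigma = 3 ->
  cut_pairs sigma m D
  = @mirror_pair _ @^-1: cut_pairs (opposite sigma) m (opposite_desc m D).
Proof.
move=> size3; apply/setP => -[e1 e2]; rewrite !inE /= !subSS.
rewrite -(cuts_fit_opposite (c := [:: e1 : nat; e2 : nat])) //=; last first.
  by rewrite !leq_ord.
by congr (_ && _); have := ltn_ord e1; lia.
Qed.

Lemma peaks_mirror m (D : nat -> bool) :
  peaks m D = @rev_ord _ @^-1: peaks m (opposite_desc m D).
Proof.
apply/setP => e; rewrite !inE /= subSS.
by rewrite -(cuts_fit_opposite (c := [:: e : nat])) //= leq_ord.
Qed.

Lemma card_cut_pairs_pmm m D :
  #|cut_pairs pmm m D|
  = 2 * (cut_pairs pmm m D != set0)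
    + \sum_(e in peaks m D) (m.+1 - e)
    + ((peaks m D != set0) && [exists i : 'I_m, ~~ D i]).
Proof.
pose D' := opposite_desc m D.
have someE : [exists i : 'I_m, ~~ D i] = [exists i : 'I_m, D' i].
  apply/existsP/existsP => -[i Di]; exists (rev_ord i) => //.
  by rewrite /D' /opposite_desc -[m - _]/(val (rev_ord _)) rev_ordK.
have sumE : \sum_(e in peaks m D) (m.+1 - e) = \sum_(e in peaks m D') e.
  rewrite [RHS](reindex_inj rev_ord_inj) peaks_mirror.
  by apply: eq_big => e; rewrite /= ?inE // subSS.
rewrite sumE someE cut_pairs_mirror // (peaks_mirror m D) -!card_gt0.
rewrite !card_preimset; [|exact: rev_ord_inj|exact: inv_inj (@mirror_pairK _)].
by rewrite !card_gt0; apply: card_cut_pairs_ppm.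
Qed.

(** * Classes of signatures *)

Lemma nth_oneline n (s : 'S_n.+1) i : i <= n ->
  nth 0 (oneline s) i = s (inord i).
Proof.
move=> le_in; rewrite (nth_map ord0) ?size_enum_ord //.
by congr (val (s _)); apply: val_inj; rewrite /= nth_enum_ord ?inordK.
Qed.

Definition monotone_seq (b : bool) (w : seq nat) : bool :=
  if b then sorted ltn w else sorted (fun x y => y < x) w.

Lemma sorted_segmentP (T : Type) (x0 : T) (e : rel T) w a c : c <= size w ->
  reflect (forall i, a <= i -> i.+1 < c -> e (nth x0 w i) (nth x0 w i.+1))
          (sorted e (drop a (take c w))).
Proof.
move=> le_c; have size_seg : size (drop a (take c w)) = c - a.
  by rewrite size_drop size_takel.
apply: (iffP (sortedP x0)) => step i.
  move=> le_ai lt_ic; have := step (i - a); rewrite size_seg !nth_drop addnS.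
  by rewrite subnKC // !nth_take //; [apply; lia | lia].
rewrite size_seg !nth_drop addnS => lt_i.
by rewrite !nth_take; [apply: step|..]; lia.
Qed.

Lemma monotone_segmentP m (s : 'S_m.+1) b a c : c <= m.+1 ->
  reflect (forall i, a <= i -> i.+1 < c -> desc s i = ~~ b)
          (monotone_seq b (drop a (take c (oneline s)))).
Proof.
move=> le_c; have le_size : c <= size (oneline s).
  by rewrite size_map size_enum_ord.
have nthE i : i.+1 < c -> (nth 0 (oneline s) i, nth 0 (oneline s) i.+1)
    = (s (inord i) : nat, s (inord i.+1) : nat).
  by move=> lt_ic; rewrite !nth_oneline //; lia.
case: b; apply: (iffP (sorted_segmentP 0 _ _ le_size)) => step i le_ai lt_ic;
  have := step i le_ai lt_ic; have [-> ->] := nthE i lt_ic => //;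
  by rewrite /= ltn_perm_succ; [case: desc | lia].
Qed.

Lemma cuts_fit_segmentsP m e1 e2 b0 b1 b2 (D : nat -> bool) :
    e1 <= e2 -> e2 <= m.+1 ->
  reflect [/\ forall i, 0 <= i -> i.+1 < e1 -> D i = ~~ b0,
              forall i, e1 <= i -> i.+1 < e2 -> D i = ~~ b1 &
              forall i, e2 <= i -> i.+1 < m.+1 -> D i = ~~ b2]
          (cuts_fit [:: b0; b1; b2] [:: e1; e2] m D).
Proof.
move=> le_e12 le_e2.
have signE i : is_minus [:: b0; b1; b2] (block [:: e1; e2] i)
    = ~~ (if i < e1 then b0 else if i < e2 then b1 else b2).
  rewrite /block /is_minus /=; case: (leqP e1 i) => [_|lt_ie1].
    by case: leqP.
  by rewrite leqNgt (leq_trans lt_ie1).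
apply: (iffP (cuts_fitP _ _ _ _)) => [fit | [seg0 seg1 seg2] i lt_im].
  by split=> i le_i lt_i; rewrite fit ?signE ?inE; try lia;
    case: (ltnP i e1); try lia; case: (ltnP i e2); lia.
rewrite !inE signE negb_or => /andP[ne_e1 ne_e2].
case: ltnP => [lt_ie1|le_e1i]; first by apply: seg0 => //; lia.
case: ltnP => [lt_ie2|le_e2i]; first by apply: seg1 => //; lia.
exact: seg2.
Qed.

Lemma in_class_three_segments n b0 b1 b2 (w : seq nat) :
  reflect (exists e : 'I_n.+1 * 'I_n.+1,
             [/\ e.1 <= e.2, monotone_seq b0 (drop 0 (take e.1 w)),
                 monotone_seq b1 (drop e.1 (take e.2 w)) &
                 monotone_seq b2 (drop e.2 (take n w))])
          (in_class n [:: b0; b1; b2] w).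
Proof.
apply: (iffP existsP) => [[e] | [[e1 e2] /= [le_e12 seg0 seg1 seg2]]].
  case/and4P=> /eqP e_first /eqP e_last /forallP le_e /forallP seg.
  have e0 : e (inord 0) = 0 :> nat.
    rewrite -[RHS]e_first; congr (val (e _)).
    by apply: val_inj; rewrite /= inordK.
  have e3 : e (inord 3) = n :> nat.
    rewrite -[RHS]e_last; congr (val (e _)).
    by apply: val_inj; rewrite /= inordK.
  exists (e (inord 1), e (inord 2)); split=> /=.
  - have /forallP/(_ (inord 2))/implyP := le_e (inord 1); apply.
    by rewrite !inordK.
  - by have := seg (@Ordinal 3 0 isT); rewrite /= e0.
  - exact: seg (@Ordinal 3 1 isT).
  - by have := seg (@Ordinal 3 2 isT); rewrite /= e3.
exists [ffun i : 'I_4 => nth ord_max [:: ord0; e1; e2] i].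
rewrite !ffunE /= !eqxx /=; apply/andP; split.
  apply/'forall_forallP => i j; apply/implyP; rewrite !ffunE.
  by case: i => -[|[|[|[|i]]]] // ?; case: j => -[|[|[|[|j]]]] //= ? _;
    rewrite ?leq_ord.
by apply/forallP => -[[|[|[|i]]] ?] //=; rewrite !ffunE !inordK.
Qed.

Lemma in_class_cut_pairs m b0 b1 b2 (s : 'S_m.+1) :
  in_class m.+1 [:: b0; b1; b2] (oneline s)
  = (cut_pairs [:: b0; b1; b2] m (desc s) != set0).
Proof.
apply/in_class_three_segments/set0Pn => -[[e1 e2]] /=.
  case=> le_e12 /monotone_segmentP-/(_ (leq_ord e1)) seg0.
  move=> /monotone_segmentP-/(_ (leq_ord e2)) seg1.
  move=> /monotone_segmentP-/(_ (leqnn _)) seg2.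
  exists (e1, e2); rewrite inE le_e12.
  by apply/cuts_fit_segmentsP; rewrite ?leq_ord.
rewrite inE /= => /andP[le_e12].
case/(cuts_fit_segmentsP _ _ _ _ le_e12 (leq_ord e2)) => seg0 seg1 seg2.
exists (e1, e2); split=> //=;
  by apply/monotone_segmentP; rewrite ?leq_ord.
Qed.

Lemma cntE m b0 b1 b2 : cnt [:: b0; b1; b2] m.+1
  = \sum_(s : 'S_m.+1 | cyclicp s)
      (cut_pairs [:: b0; b1; b2] m (desc s) != set0).
Proof.
rewrite /cnt /Cclass card_set_sum [RHS]big_mkcond; apply: eq_bigr => s _.
by rewrite in_class_cut_pairs; case: cyclicp.
Qed.

Lemma sum_card_cut_pairs_ppm m :
  \sum_(s : 'S_m.+1 | cyclicp s) #|cut_pairs ppm m (desc s)|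
  = 2 * c5 m.+1
    + \sum_(s : 'S_m.+1 | cyclicp s) \sum_(e in peaks m (desc s)) e
    + \sum_(s : 'S_m.+1 | cyclicp s)
        ((peaks m (desc s) != set0) && [exists i : 'I_m, desc s i]).
Proof.
rewrite /c5 cntE big_distrr -!big_split.
by apply: eq_bigr => s _; apply: card_cut_pairs_ppm.
Qed.

Lemma sum_card_cut_pairs_pmm m :
  \sum_(s : 'S_m.+1 | cyclicp s) #|cut_pairs pmm m (desc s)|
  = 2 * c6 m.+1
    + \sum_(s : 'S_m.+1 | cyclicp s) \sum_(e in peaks m (desc s)) (m.+1 - e)
    + \sum_(s : 'S_m.+1 | cyclicp s)
        ((peaks m (desc s) != set0) && [exists i : 'I_m, ~~ desc s i]).
Proof.
rewrite /c6 cntE big_distrr -!big_split.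
by apply: eq_bigr => s _; apply: card_cut_pairs_pmm.
Qed.

Section CyclicSums.

Variable m : nat.
Hypothesis n_mod4 : m.+1 %% 4 != 2.

Lemma card_cyclic_cut_pairs_opposite sigma e : size sigma = 3 ->
  #|[set s : 'S_m.+1 | cyclicp s && (e \in cut_pairs sigma m (desc s))]|
  = #|[set s : 'S_m.+1 | cyclicp s &&
         (mirror_pair e \in cut_pairs (opposite sigma) m (desc s))]|.
Proof.
case: e => e1 e2 size3.
have le_mirror : (rev_ord e2 <= rev_ord e1) = (e1 <= e2).
  by rewrite /=; have := ltn_ord e1; lia.
under eq_finset => s do rewrite inE /=.
under [in RHS]eq_finset => s do rewrite inE le_mirror /= !subSS.
case: (e1 <= e2) => /=; last first.
  by rewrite !eq_card0 // => s; rewrite inE andbF.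
by rewrite (card_cyclic_opposite n_mod4) //= !leq_ord.
Qed.

Lemma sum_card_cut_pairs_opposite sigma : size sigma = 3 ->
  \sum_(s : 'S_m.+1 | cyclicp s) #|cut_pairs sigma m (desc s)|
  = \sum_(s : 'S_m.+1 | cyclicp s) #|cut_pairs (opposite sigma) m (desc s)|.
Proof.
move=> size3; under eq_bigr => s _ do rewrite -sum1_card.
under [RHS]eq_bigr => s _ do rewrite -sum1_card.
rewrite !sum_exchange_card [RHS](reindex_inj (inv_inj (@mirror_pairK _))).
by apply: eq_bigr => e _; rewrite card_cyclic_cut_pairs_opposite.
Qed.

Lemma sum_peaks_rev_ord :
  \sum_(s : 'S_m.+1 | cyclicp s) \sum_(e in peaks m (desc s)) e
  = \sum_(s : 'S_m.+1 | cyclicp s) \sum_(e in peaks m (desc s)) (m.+1 - e).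
Proof.
rewrite !sum_exchange_card [RHS](reindex_inj rev_ord_inj).
apply: eq_bigr => e _; rewrite /= subSS subKn ?leq_ord //; congr (_ * _).
under eq_finset => s do rewrite inE.
under [in RHS]eq_finset => s do rewrite inE /= subSS.
by rewrite (card_cyclic_opposite n_mod4) //= leq_ord.
Qed.

Lemma sum_peaks_exists_desc :
  \sum_(s : 'S_m.+1 | cyclicp s)
    ((peaks m (desc s) != set0) && [exists i : 'I_m, desc s i])
  = \sum_(s : 'S_m.+1 | cyclicp s)
      ((peaks m (desc s) != set0) && [exists i : 'I_m, ~~ desc s i]).
Proof.
apply: eq_bigr => s cyc_s; rewrite cyclicp_exists_desc //.
by apply: contraNneq n_mod4 => ->.
Qed.

End CyclicSums.

Theorem theorem5p2 (n : nat) : 1 <= n -> n %% 4 != 2 -> c5 n = c6 n.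
Proof.
case: n => // m _ n_mod4.
have := sum_card_cut_pairs_opposite n_mod4 (erefl (size ppm)).
rewrite sum_card_cut_pairs_ppm sum_card_cut_pairs_pmm.
rewrite sum_peaks_rev_ord // sum_peaks_exists_desc // => /addIn/addIn/eqP.
by rewrite eqn_pmul2l // => /eqP.
Qed.
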